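(* Suppose the generalized discrete stochastic Lagrangian $R_d:\Omega\times Q\times T^*Q\to\mathbb{R}$, $R_d(q_k,q_{k+1},p_{k+1})=p_{k+1}q_{k+1}-H^+_d(q_k,p_{k+1})$, is invariant under the action of the Lie group $G$, that is, $$R_d\Big(\Phi^{Q\times T^*Q}_g(q_k,q_{k+1},p_{k+1})\Big)=R_d(q_k,q_{k+1},p_{k+1})\qquad\text{for all } g\in G.$$ If the discrete forces $F^\pm_d$ satisfy the condition $$F^-_d(q_k,p_{k+1})\cdot\xi_Q(q_k)+F^+_d(q_k,p_{k+1})\cdot\xi^p_{T^*Q}(q_{k+1},p_{k+1})=0$$ for all $\xi\in\mathfrak{g}$ and all $(q_k,q_{k+1},p_{k+1})\in Q\times T^*Q$, then the cotangent lift momentum map $J$ associated with $\Phi^{T^*Q}$ is almost surely preserved along the solutions of the discrete equations $$q_{k+1}=D_2H^+_d(q_k,p_{k+1})-F^+_d(q_k,p_{k+1}),\qquad p_k=D_1H^+_d(q_k,p_{k+1})-F^-_d(q_k,p_{k+1}),$$ i.e., almost surely $J(q_{k+1},p_{k+1})=J(q_k,p_k)$.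
   Context: Setting: $Q\cong\mathbb{R}^N$, $T^*Q\cong\mathbb{R}^N\times\mathbb{R}^N$. $H^+_d$ (a random real-valued, differentiable function, the discrete Hamiltonian) and $F^\pm_d$ (random $\mathbb{R}^N$-valued functions, the discrete forces) are functions of $(q_k,p_{k+1})\in\mathbb{R}^N\times\mathbb{R}^N$; the dependence on $\omega\in\Omega$ and on the times $t_k,t_{k+1}$ is suppressed. $D_1,D_2$ are derivatives with respect to the first and second arguments. Products of vectors denote scalar products. Group action: the Lie group $G$, with Lie algebra $\mathfrak{g}$, acts on $Q$ by a left action $\Phi:G\times Q\to Q$, $\Phi_g=\Phi(g,\cdot)$. The cotangent lift action is, in coordinates (summation over repeated indices), $$\Phi^{T^*Q}_g(q,p)=\Big(\Phi^i_g(q),\ p_j\frac{\partial\Phi^j_{g^{-1}}}{\partial q^i}(\Phi_g(q))\Big),$$ and the action on $Q\times T^*Q$ is $\Phi^{Q\times T^*Q}_g(q_k,q_{k+1},p_{k+1})=\big(\Phi_g(q_k),\Phi^{T^*Q}_g(q_{k+1},p_{k+1})\big)$. For $\xi\in\mathfrak{g}$ the infinitesimal generators are $\xi_Q(q)=\frac{d}{d\lambda}\big|_{\lambda=0}\Phi_{\exp\lambda\xi}(q)$ and $\xi_{T^*Q}(q,p)=\frac{d}{d\lambda}\big|_{\lambda=0}\Phi^{T^*Q}_{\exp\lambda\xi}(q,p)$, whose $q$- and $p$-components are denoted $\xi^q_{T^*Q}(q,p)$ and $\xi^p_{T^*Q}(q,p)$. The cotangent lift momentum map $J:T^*Q\to\mathfrak{g}^*$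 is given by $\langle J(q,p),\xi\rangle=p\cdot\xi_Q(q)$ for all $\xi\in\mathfrak{g}$. *)

(* Defs.v *)
From HB Require Import structures.
From mathcomp Require Import all_boot all_order all_algebra.
From mathcomp Require Import all_classical all_reals all_analysis.

Set Implicit Arguments.
Unset Strict Implicit.
Unset Printing Implicit Defensive.

Import Order.TTheory GRing.Theory Num.Theory.
Import numFieldNormedType.Exports.

Local Open Scope classical_set_scope.
Local Open Scope ring_scope.

(* [Cn_on k U f] is used for finite-dimensional [V] and open [U] only.  There
   it says that f is k times continuously differentiable on U: all its iterated
   directional derivatives up to order k exist and are continuous on U. *)
Fixpoint Cn_on (R : realType) (V W : normedModType R) (k : nat) (U : set V)
    (f : V -> W) : Prop :=
  match k with
  | 0 => forall x, U x -> {for x, continuous f}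
  | k'.+1 => (forall x, U x -> differentiable f x) /\
             (forall v : V, Cn_on k' U (fun x => 'D_v f x))
  end.

Definition smooth_on (R : realType) (V W : normedModType R) (U : set V)
    (f : V -> W) : Prop :=
  forall k, Cn_on k U f.

(* A homeomorphism from an open subset of M onto an open subset of V; outside
   of these sets the values of the two maps carry no information. *)
Record chart (R : realType) (V : normedModType R) (M : topologicalType) :=
  Chart {
    chart_dom : set M;
    chart_cod : set V;
    chart_to : M -> V;
    chart_from : V -> M;
    chart_dom_open : open chart_dom;
    chart_cod_open : open chart_cod;
    chart_to_cod : forall x, chart_dom x -> chart_cod (chart_to x);
    chart_from_dom : forall v, chart_cod v -> chart_dom (chart_from v);
    chart_toK : forall x, chart_dom x -> chart_from (chart_to x) = x;
    chart_fromK : forall v, chart_cod v -> chart_to (chart_from v) = v;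
    chart_to_cts : forall x, chart_dom x -> {for x, continuous chart_to};
    chart_from_cts : forall v, chart_cod v -> {for v, continuous chart_from}
  }.

Definition smooth_atlas (R : realType) (V : normedModType R)
    (M : topologicalType) (A : set (chart V M)) : Prop :=
  (forall x, exists2 c, A c & chart_dom c x) /\
  (forall c d, A c -> A d ->
     smooth_on (chart_cod c `&` chart_from c @^-1` chart_dom d)
               (chart_to d \o chart_from c)).

Definition smooth_map (R : realType) (V W : normedModType R)
    (M N : topologicalType) (A : set (chart V M)) (B : set (chart W N))
    (f : M -> N) : Prop :=
  continuous f /\
  (forall c d, A c -> B d ->
     smooth_on (chart_cod c `&` chart_from c @^-1` (f @^-1` chart_dom d))
               (chart_to d \o f \o chart_from c)).

Section StandardCharts.
Variable R : realType.

Definition id_chart (V : normedModType R) : chart V V.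
Proof.
refine (@Chart R V V setT setT id id openT openT _ _ _ _ _ _) => // x _;
  exact: cvg_id.
Defined.

Variables (V W : normedModType R) (M N : topologicalType).
Variables (c : chart V M) (d : chart W N).

Let to_prod (x : M * N) : V * W := (chart_to c x.1, chart_to d x.2).
Let from_prod (v : V * W) : M * N := (chart_from c v.1, chart_from d v.2).

Lemma open_setX (S T : topologicalType) (A : set S) (B : set T) :
  open A -> open B -> open (A `*` B).
Proof.
move=> oA oB; rewrite openE => -[x y] [/= Ax By]; rewrite /interior.
by exists (A, B) => //; split => /=; apply: open_nbhs_nbhs.
Qed.

Lemma to_prod_cts x : (chart_dom c `*` chart_dom d) x ->
  {for x, continuous to_prod}.
Proof.
case: x => x y [/= cx dy]; apply: cvg_pair => /=.
  by apply: (cvg_comp fst (chart_to c)); [exact: cvg_fst|exact: chart_to_cts].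
by apply: (cvg_comp snd (chart_to d)); [exact: cvg_snd|exact: chart_to_cts].
Qed.

Lemma from_prod_cts v : (chart_cod c `*` chart_cod d) v ->
  {for v, continuous from_prod}.
Proof.
case: v => v w [/= cv dw]; apply: cvg_pair => /=.
  by apply: (cvg_comp fst (chart_from c)); [exact: cvg_fst|exact: chart_from_cts].
by apply: (cvg_comp snd (chart_from d)); [exact: cvg_snd|exact: chart_from_cts].
Qed.

Definition prod_chart : chart (V * W)%type (M * N)%type.
Proof.
refine (@Chart R (V * W)%type (M * N)%type
  (chart_dom c `*` chart_dom d) (chart_cod c `*` chart_cod d)
  to_prod from_prod _ _ _ _ _ _ to_prod_cts from_prod_cts).
- by apply: open_setX; exact: chart_dom_open.
- by apply: open_setX; exact: chart_cod_open.
- by move=> x [xc xd]; split; exact: chart_to_cod.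
- by move=> v [vc vd]; split; exact: chart_from_dom.
- by move=> [x y] [xc yd]; rewrite /from_prod /= !chart_toK.
- by move=> [v w] [vc wd]; rewrite /to_prod /= !chart_fromK.
Defined.

End StandardCharts.

Definition self_atlas (R : realType) (V : normedModType R) : set (chart V V) :=
  [set id_chart V].
Arguments self_atlas {R} V _.

Definition prod_atlas (R : realType) (V W : normedModType R)
    (M N : topologicalType) (A : set (chart V M)) (B : set (chart W N)) :
    set (chart (V * W)%type (M * N)%type) :=
  [set prod_chart c d | c in A & d in B].

(* Real Lie groups of dimension n.  The distinguished chart at the identity is
   an arbitrary element of the atlas; it only serves to write tangent vectors at
   the identity in coordinates. *)
HB.mixin Record isLieGroup (R : realType) (n : nat) (G : Type)
    of Group G & Topological G := {
  lie_atlas : set (chart 'rV[R]_n G);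
  lie_chart1 : chart 'rV[R]_n G;
  lie_hausdorff : hausdorff_space G;
  lie_second_countable : @second_countable G;
  lie_smooth_atlas : smooth_atlas lie_atlas;
  lie_chart1_atlas : lie_atlas lie_chart1;
  lie_chart1_dom : chart_dom lie_chart1 1%g;
  lie_smooth_mul : smooth_map (prod_atlas lie_atlas lie_atlas) lie_atlas
                     (fun gh : G * G => (gh.1 * gh.2)%g);
  lie_smooth_inv : smooth_map lie_atlas lie_atlas (fun g : G => g^-1%g)
}.

#[short(type="lieGroupType")]
HB.structure Definition LieGroup (R : realType) (n : nat) :=
  { G of isLieGroup R n G & Group G & Topological G }.

Section LieAlgebra.
Variables (R : realType) (n : nat).

(* The tangent space of G at the identity, in the coordinates of [lie_chart1].
   Only its vector space structure is needed, so the bracket is left out. *)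
Definition lie_algebra (_ : lieGroupType R n) := 'rV[R]_n.

Definition lie_dual (G : lieGroupType R n) := 'Hom(lie_algebra G, R^o).

Variable G : lieGroupType R n.

Definition one_parameter_subgroup (gamma : R -> G) : Prop :=
  (forall s t, gamma (s + t) = (gamma s * gamma t)%g) /\
  smooth_map (self_atlas R) (@lie_atlas R n G) gamma.

Definition velocity1 (gamma : R -> G) : lie_algebra G :=
  derive1 (fun t => chart_to (@lie_chart1 R n G) (gamma t)) 0.

(* exp xi = gamma 1 for the one-parameter subgroup gamma of velocity xi.  By
   the standard theory there is exactly one, so that the default value of
   [xget] is never taken. *)
Definition lie_exp (xi : lie_algebra G) : G :=
  xget (fun=> 1%g)
    [set gamma | one_parameter_subgroup gamma /\ velocity1 gamma = xi] 1.

End LieAlgebra.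

Definition dotv (R : realType) (N : nat) (u v : 'rV[R]_N) : R :=
  \sum_(i < N) u 0 i * v 0 i.

Definition pderiv (R : realType) (N : nat) (W : normedModType R)
    (f : 'rV[R]_N -> W) (i : 'I_N) (x : 'rV[R]_N) : W :=
  'D_(delta_mx 0 i) f x.

Section Action.
Variables (R : realType) (n N : nat) (G : lieGroupType R n).
Variable Phi : G -> 'rV[R]_N -> 'rV[R]_N.

Definition smooth_left_action : Prop :=
  [/\ forall q, Phi 1%g q = q,
      forall g h q, Phi (g * h)%g q = Phi g (Phi h q) &
      smooth_map (prod_atlas (@lie_atlas R n G) (self_atlas 'rV[R]_N))
        (self_atlas 'rV[R]_N) (fun gq : G * 'rV[R]_N => Phi gq.1 gq.2)].

Definition cotangent_lift (g : G) (z : 'rV[R]_N * 'rV[R]_N) :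
    'rV[R]_N * 'rV[R]_N :=
  (Phi g z.1,
   \row_(i < N) \sum_(j < N) z.2 0 j * pderiv (Phi g^-1%g) i (Phi g z.1) 0 j).

Definition action_QTQ (g : G) (z : 'rV[R]_N * ('rV[R]_N * 'rV[R]_N)) :
    'rV[R]_N * ('rV[R]_N * 'rV[R]_N) :=
  (Phi g z.1, cotangent_lift g z.2).

Definition generatorQ (xi : lie_algebra G) (q : 'rV[R]_N) : 'rV[R]_N :=
  derive1 (fun l : R => Phi (lie_exp (l *: xi)) q) 0.

Definition generatorTQ (xi : lie_algebra G) (z : 'rV[R]_N * 'rV[R]_N) :
    'rV[R]_N * 'rV[R]_N :=
  derive1 (fun l : R => cotangent_lift (lie_exp (l *: xi)) z) 0.

(* Since xi |-> generatorQ xi q is linear, there is exactly one such J. *)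
Definition cotangent_momentum_map
    (J : 'rV[R]_N * 'rV[R]_N -> lie_dual G) : Prop :=
  forall q p (xi : lie_algebra G), J (q, p) xi = dotv p (generatorQ xi q).

End Action.

Section DiscreteHamiltonian.
Variables (R : realType) (N : nat).
Implicit Types (H : 'rV[R]_N -> 'rV[R]_N -> R).

Definition D1 H (q p : 'rV[R]_N) : 'rV[R]_N :=
  \row_(i < N) pderiv (fun x => H x p) i q.

Definition D2 H (q p : 'rV[R]_N) : 'rV[R]_N :=
  \row_(i < N) pderiv (fun y => H q y) i p.

(* evaluated at z = (q_k, (q_(k+1), p_(k+1))) *)
Definition discrete_lagrangian H (z : 'rV[R]_N * ('rV[R]_N * 'rV[R]_N)) : R :=
  dotv z.2.2 z.2.1 - H z.1 z.2.2.

End DiscreteHamiltonian.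

Definition random_vector (d : measure_display) (Omega : measurableType d)
    (R : realType) (N : nat) (X : Omega -> 'rV[R]_N) : Prop :=
  forall i : 'I_N, measurable_fun [set: Omega] (fun w => X w 0 i).

(* Main.v *)
Require Import Defs.
From HB Require Import structures.
From mathcomp Require Import all_boot all_order all_algebra.
From mathcomp Require Import all_classical all_reals all_analysis.
From mathcomp Require Import lra.

Set Implicit Arguments.
Unset Strict Implicit.
Unset Printing Implicit Defensive.

Import Order.TTheory GRing.Theory Num.Theory.
Import numFieldNormedType.Exports.

Local Open Scope classical_set_scope.
Local Open Scope ring_scope.

(* Differentiating the invariance of R_d along [lie_exp (l *: xi)] at l = 0 gives
     xi^p . q' + p' . xi_Q(q') = D1 H(q,p') . xi_Q(q) + D2 H(q,p') . xi^p,
   and substituting the discrete equations and the condition on the forces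
   leaves p' . xi_Q(q') = p . xi_Q(q).  The analytic point is that
   [lie_exp (l *: xi)] acts like a fixed one-parameter subgroup evaluated at l,
   because one-parameter subgroups of equal velocity induce the same flow on Q.
   In local coordinates on G the p-component of the lifted flow is then a
   partial derivative of the smooth action along a differentiable curve. *)

(** * Differential calculus of curves in normed spaces *)

Section Curves.
Context {R : realType}.
Implicit Types V W : normedModType R.

(** The two difference quotients agree. The domains may differ, so a partial derivative can be read
    as a directional derivative on a product. *)
Lemma eq_derive (U V W : normedModType R) (f : U -> W) (g : V -> W) x v y w :
  (forall h : R, f (h *: v + x) = g (h *: w + y)) -> 'D_v f x = 'D_w g y.
Proof.
move=> fg; rewrite /derive.
have fgxy : f x = g y by have := fg 0; rewrite !scale0r !add0r.
rewrite (_ : (fun h => h^-1 *: ((f \o shift x) (h *: v) - f x)) =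
  (fun h => h^-1 *: ((g \o shift y) (h *: w) - g y)))//.
by apply/funext => h /=; rewrite fgxy fg.
Qed.

Lemma is_derive_diff_comp V W (f : V -> W) (c : R -> V) (t : R) v :
  differentiable f (c t) -> is_derive t 1 c v ->
  is_derive t 1 (f \o c) ('d f (c t) v).
Proof.
move=> df [/derivable1_diffP dc <-].
have dfc : differentiable (f \o c) t by exact: differentiable_comp.
apply: DeriveDef; first exact/derivable1_diffP.
by rewrite !deriveE// diff_comp.
Qed.

Lemma is_derive_pair V W (c : R -> V) (e : R -> W) (t : R) v w :
  is_derive t 1 c v -> is_derive t 1 e w ->
  is_derive t 1 (fun s => (c s, e s)) (v, w).
Proof.
move=> [/derivable1_diffP dc <-] [/derivable1_diffP de <-].
have dce : differentiable (fun s => (c s, e s)) t.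
  exact: differentiable_pair.
apply: DeriveDef; first exact/derivable1_diffP.
by rewrite !deriveE// diff_pair.
Qed.

Lemma derive1_is_derive V (c : R -> V) (t : R) v : 
  is_derive t 1 c v -> derive1 c t = v.
Proof. by move=> dc; rewrite derive1E derive_val. Qed.

Lemma is_derive_shift0 V (c : R -> V) (t : R) v :
  is_derive (0 : R) 1 (fun s => c (s + t)) v -> is_derive t 1 c v.
Proof.
have E : (fun h : R => h^-1 *: (c (h *: 1 + 0 + t) - c (0 + t))) =
    (fun h => h^-1 *: (c (h *: 1 + t) - c t)).
  by apply/funext => h; rewrite addr0 add0r.
move=> [dc <-]; apply: DeriveDef.
  by move: dc; rewrite /derivable /= E.
by rewrite /derive /= E.
Qed.

Lemma is_derive_opp0 V (c : R -> V) v :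
  is_derive (0 : R) 1 c v -> is_derive (0 : R) 1 (fun s => c (- s)) (- v).
Proof.
move=> [dc <-].
have dc0 : differentiable c (- 0) by rewrite oppr0; exact/derivable1_diffP.
have := is_derive_diff_comp dc0 (is_deriveNid (0 : R) 1).
by rewrite linearN oppr0 -deriveE//; exact/derivable1_diffP.
Qed.

Lemma is_derive_coord m (c : R -> 'rV[R]_m) (t : R) v i :
  is_derive t 1 c v -> is_derive t 1 (fun s => c s 0 i) (v 0 i).
Proof.
move=> [dc <-]; apply: DeriveDef; first by move/derivable_mxP: dc; apply.
by rewrite derive_mx// mxE.
Qed.

Lemma is_derive0_cst_rV m (c : R -> 'rV[R]_m) :
  (forall t : R, is_derive t 1 c 0) -> forall s t, c s = c t.
Proof.
move=> dc s t; apply/rowP => i.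
apply: (@is_derive_0_is_cst R (fun r => c r 0 i)) => r.
by have := is_derive_coord i (dc r); rewrite mxE.
Qed.

Lemma is_derive_dotv m (c e : R -> 'rV[R]_m) (t : R) v w :
  is_derive t 1 c v -> is_derive t 1 e w ->
  is_derive t 1 (fun s => dotv (c s) (e s)) (dotv v (e t) + dotv (c t) w).
Proof.
move=> dc de.
have -> : (fun s => dotv (c s) (e s)) =
    \sum_(i < m) ((fun s => c s 0 i) * (fun s => e s 0 i)).
  by apply/funext => s; rewrite fct_sumE.
have := is_derive_sum (fun i =>
  is_deriveM (is_derive_coord i dc) (is_derive_coord i de)).
move=> /is_derive_eq; apply; rewrite /dotv -big_split/=.
apply: eq_bigr => i _.
by rewrite addrC; congr (_ + _); rewrite /GRing.scale/= mulrC.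
Qed.

End Curves.

(** * Smooth actions and the flows of one-parameter subgroups *)

Section Action.
Context {R : realType} {n N : nat} {G : lieGroupType R n}.
Variable Phi : G -> 'rV[R]_N -> 'rV[R]_N.
Hypothesis Phi_action : smooth_left_action Phi.
Implicit Types (g h : G) (x q : 'rV[R]_N).
Local Notation chart1 := (@lie_chart1 R n G).

Lemma act1 q : Phi 1%g q = q.
Proof. by case: Phi_action => + _ _; apply. Qed.

Lemma actM g h q : Phi (g * h)%g q = Phi g (Phi h q).
Proof. by case: Phi_action => _ + _; apply. Qed.

Lemma actVK g h : Phi g =1 Phi h -> Phi g^-1%g =1 Phi h^-1%g.
Proof.
move=> gh q.
by rewrite -[in LHS](act1 q) -(mulgV h) actM -gh -actM mulVg act1.
Qed.

(** The lift depends on [g] only through [Phi g] and [Phi g^-1], so [lie_exp] may be replaced by any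
    curve inducing the same flow on Q. *)
Lemma eq_cotangent_lift g h : Phi g =1 Phi h ->
  cotangent_lift Phi g =1 cotangent_lift Phi h.
Proof.
move=> gh z; rewrite /cotangent_lift gh.
have -> // : Phi g^-1%g = Phi h^-1%g by apply/funext; exact: actVK.
Qed.

(** The group variable is read in the chart [c], which gives a map between normed spaces, to which
    differentials apply. *)
Definition local_action (c : chart 'rV[R]_n G) (z : 'rV[R]_n * 'rV[R]_N) :=
  Phi (chart_from c z.1) z.2.

Lemma local_actionE (c : chart 'rV[R]_n G) g q :
  chart_dom c g -> local_action c (chart_to c g, q) = Phi g q.
Proof. by move=> cg; rewrite /local_action/= chart_toK. Qed.

Lemma local_action_smooth c : lie_atlas c ->
  smooth_on (chart_cod c `*` setT) (local_action c).
Proof.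
move=> Ac; case: Phi_action => _ _ [_ smo].
have Acid : prod_atlas (@lie_atlas R n G) (self_atlas 'rV[R]_N)
   (prod_chart c (id_chart 'rV[R]_N)) by exists c => //; exists (id_chart _).
have := smo _ (id_chart 'rV[R]_N) Acid erefl.
congr (smooth_on _ _).
by apply/seteqP; split=> z [] //=.
Qed.

Lemma local_action_differentiable c g q : lie_atlas c -> chart_dom c g ->
  differentiable (local_action c) (chart_to c g, q).
Proof.
move=> Ac cg; have [+ _] := local_action_smooth Ac 1%N; apply.
by split => //; exact: chart_to_cod.
Qed.

(** In a chart around [g], [Phi g] is a partial map of the local action; the domain of [lie_chart1]
    may miss [g]. *)
Lemma act_differentiable g q : differentiable (Phi g) q.
Proof.
have [/(_ g)[c Ac cg] _] := @lie_smooth_atlas R n G.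
have -> : Phi g = local_action c \o (fun y => (chart_to c g, y)).
  by apply/funext => y /=; rewrite local_actionE.
apply: differentiable_comp; last exact: local_action_differentiable.
exact: differentiable_pair.
Qed.

(* Unlike [one_parameter_subgroup], smoothness is only required at 0 and in the
   distinguished chart, so that reversed and constant curves qualify at once. *)
Definition weak_subgroup (gamma : R -> G) : Prop :=
  [/\ forall s t, gamma (s + t) = (gamma s * gamma t)%g,
      {for 0, continuous gamma} &
      derivable (fun t => chart_to chart1 (gamma t)) 0 1].

Lemma weak_subgroup0 gamma : weak_subgroup gamma -> gamma 0 = 1%g.
Proof.
by move=> [gD _ _]; apply: (@mulgI _ (gamma 0)); rewrite -gD mulg1 addr0.
Qed.

Lemma weak_subgroupN gamma t : weak_subgroup gamma ->
  gamma (- t) = (gamma t)^-1%g.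
Proof.
move=> wg; apply: (@mulgI _ (gamma t)); case: (wg) => gD _ _.
by rewrite -gD subrr mulgV weak_subgroup0.
Qed.

Lemma weak_subgroup_dom gamma : weak_subgroup gamma ->
  \forall t \near (0 : R), chart_dom chart1 (gamma t).
Proof.
move=> wg; case: (wg) => _ + _; apply.
rewrite weak_subgroup0//; apply: open_nbhs_nbhs; split.
  exact: chart_dom_open.
exact: lie_chart1_dom.
Qed.

Lemma is_derive_velocity1 gamma : weak_subgroup gamma ->
  is_derive (0 : R) 1 (fun t => chart_to chart1 (gamma t)) (velocity1 gamma).
Proof. by case=> _ _ d; rewrite /velocity1 derive1E; exact: derivableP. Qed.

Lemma one_parameter_weak gamma :
  one_parameter_subgroup gamma -> weak_subgroup gamma.
Proof.
move=> [gD [gc gs]].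
have g0 : gamma 0 = 1%g by apply: (@mulgI _ (gamma 0)); rewrite -gD mulg1 addr0.
split => //; first exact: gc.
have [gs1 _] := gs (id_chart R) chart1 erefl (@lie_chart1_atlas R n G) 1%N.
apply/derivable1_diffP.
apply: gs1; split => //=.
rewrite /preimage/= g0; exact: lie_chart1_dom.
Qed.

Lemma weak_subgroup_opp gamma : weak_subgroup gamma ->
  weak_subgroup (fun t => gamma (- t)) /\
  velocity1 (fun t => gamma (- t)) = - velocity1 gamma.
Proof.
move=> wg; have d := is_derive_opp0 (is_derive_velocity1 wg).
split; last exact: derive1_is_derive.
case: wg => gD gc _; split; last by case: d.
- by move=> s t; rewrite opprD gD.
- by apply: continuous_comp; [exact: opp_continuous|rewrite oppr0].
Qed.

Lemma weak_subgroup_cst1 : weak_subgroup (fun=> 1%g) /\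
  velocity1 (fun=> 1%g : G) = 0.
Proof.
have d := is_derive_cst (chart_to chart1 1%g) (0 : R) 1.
split; last exact: derive1_is_derive.
split; [by move=> *; rewrite mulg1|exact: cvg_cst|by case: d].
Qed.

(** Chain rule for the local action at the identity. The subgroup enters the derivative only through
    [velocity1 gamma]. *)
Lemma is_derive_act gamma (y : R -> 'rV[R]_N) w : weak_subgroup gamma ->
  is_derive (0 : R) 1 y w ->
  is_derive (0 : R) 1 (fun t => Phi (gamma t) (y t))
    ('d (local_action chart1) (chart_to chart1 1%g, y 0) (velocity1 gamma, 0)
     + w).
Proof.
move=> wg dy; set z := (_, y 0).
have dL x : differentiable (local_action chart1) (chart_to chart1 1%g, x).
  apply: local_action_differentiable; first exact: lie_chart1_atlas.
  exact: lie_chart1_dom.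
(* Since [Phi 1] is the identity, the differential fixes the directions along Q. *)
have Lw : 'd (local_action chart1) z (0, w) = w.
  pose c t := (chart_to chart1 1%g, y t).
  have dc : is_derive (0 : R) 1 c (0, w) by apply: is_derive_pair.
  have [_ <-] := @is_derive_diff_comp R _ _ _ c 0 _ (dL _) dc.
  rewrite (_ : _ \o _ = y); first by case: dy.
  by apply/funext => t /=; rewrite local_actionE ?act1//; exact: lie_chart1_dom.
have -> : 'd (local_action chart1) z (velocity1 gamma, 0) + w =
   'd (local_action chart1) z (velocity1 gamma, w).
  rewrite -[in LHS]Lw -linearD; congr ('d _ _ _).
  by congr pair; rewrite /= ?addr0 ?add0r.
have dp := is_derive_pair (is_derive_velocity1 wg) dy.
have zE : (chart_to chart1 (gamma 0), y 0) = z by rewrite weak_subgroup0.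
have dz : differentiable (local_action chart1) (chart_to chart1 (gamma 0), y 0).
  by rewrite zE; exact: dL.
have := is_derive_diff_comp dz dp; rewrite zE.
apply: near_eq_is_derive; near=> t.
rewrite /= local_actionE//.
near: t; exact: weak_subgroup_dom.
Unshelve. all: by end_near. Qed.

(* The curve t |-> [Phi (gamma t) (Phi (delta (- t)) q)] has zero derivative:
   by the group law its derivative at t is the image under the differential of
   [Phi (gamma t)] of the derivative at 0 of such a curve. *)
Lemma eq_velocity_act gamma delta :
  weak_subgroup gamma -> weak_subgroup delta ->
  velocity1 gamma = velocity1 delta -> forall t, Phi (gamma t) =1 Phi (delta t).
Proof.
move=> wg wd gd t q.
have [wdN vdN] := weak_subgroup_opp wd.
pose u x s := Phi (gamma s) (Phi (delta (- s)) x).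
(* The contributions of [velocity1 gamma] and of [- velocity1 delta] cancel. *)
have d0 x : is_derive (0 : R) 1 (u x) 0.
  have := is_derive_act wg (is_derive_act wdN (is_derive_cst x (0 : R) 1)).
  move=> /is_derive_eq; apply.
  rewrite /= oppr0 weak_subgroup0// act1 addr0 vdN gd -linearD.
  rewrite (_ : _ + _ = 0) ?linear0//.
  by congr pair; rewrite /= ?subrr ?addr0.
have dt x (s : R) : is_derive s 1 (u x) 0.
  apply: is_derive_shift0.
  have := is_derive_diff_comp (act_differentiable (gamma s) _)
    (d0 (Phi (delta (- s)) x)).
  rewrite linear0; congr is_derive; apply/funext => r; rewrite /u /=.
  case: wg => gD _ _; case: wd => dD _ _.
  by rewrite (addrC r) gD opprD (addrC (- s)) dD !actM.
(* Started from [Phi (delta t) q], the curve takes the value [Phi (gamma t) q] at time t and its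
   starting point at time 0. *)
have := is_derive0_cst_rV (dt (Phi (delta t) q)) t 0.
rewrite /u oppr0 !weak_subgroup0// !act1 => <-.
by rewrite -(actM (delta (- t))) weak_subgroupN// mulVg act1.
Qed.

End Action.

(** * Time rescaling of one-parameter subgroups *)

Section OneParameterSubgroups.
Context {R : realType}.

(** The chain rule factor [a] is absorbed into the direction of differentiation, so the induction
    hypothesis applies to the derivative as it stands. *)
Lemma Cn_on_scale (V : normedModType R) k (U : set R) (f : R -> V) (a : R) :
  Cn_on k U f -> Cn_on k [set t | U (t * a)] (fun t => f (t * a)).
Proof.
have ca : continuous (fun t : R => t * a) by exact: mulrr_continuous.
elim: k U f => [|k IH] U f /=.
  by move=> cf x Ux; apply: continuous_comp; [exact: ca|exact: cf].
move=> [df Df]; split=> [x Ux|v].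
  apply: (@differentiable_comp _ _ _ _ (fun t : R => t * a)); last exact: df.
  exact/differentiableM.
suff -> : (fun x : R => 'D_v (fun t : R => f (t * a)) x) =
    (fun x : R => 'D_(v * a) f (x * a)) by exact: IH (Df _).
apply/funext => x; apply: eq_derive => h.
by rewrite mulrDl -scalerAl.
Qed.

Context {n : nat} {G : lieGroupType R n}.

(** Rescaling lets a single subgroup of velocity xi serve all multiples [l *: xi]. *)
Lemma one_parameter_subgroup_scale (gamma : R -> G) (a : R) :
  one_parameter_subgroup gamma ->
  one_parameter_subgroup (fun t => gamma (t * a)) /\
  velocity1 (fun t => gamma (t * a)) = a *: velocity1 gamma.
Proof.
move=> g1; have wg := one_parameter_weak g1; case: (g1) => gD [gc gs].
split; last first.
  apply: derive1_is_derive.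
  have d : differentiable
      (fun t => chart_to (@lie_chart1 R n G) (gamma t)) (0 * a).
    by rewrite mul0r; apply/derivable1_diffP; case: wg.
  have da : is_derive (0 : R) 1 (fun t : R => t * a) a.
    have := is_deriveM (is_derive_id (0 : R) 1) (is_derive_cst a (0 : R) 1).
    by move/is_derive_eq; apply; rewrite scaler0 add0r /GRing.scale/= mulr1.
  have := @is_derive_diff_comp R _ _ _ (fun t : R => t * a) 0 a d da.
  move=> /is_derive_eq; apply.
  rewrite mul0r in d *.
  by rewrite -[X in 'd _ _ X]mulr1 linearZ/= /velocity1 derive1E deriveE.
split; first by move=> s t; rewrite mulrDl gD.
split.
  move=> t; apply: continuous_comp; [exact: mulrr_continuous|exact: gc].
move=> c d -> Ad k.
exact: (@Cn_on_scale _ k _ _ a (gs (id_chart R) d erefl Ad k)).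
Qed.

End OneParameterSubgroups.

(** * The flow of the exponential and its cotangent lift *)

Section LieExpFlow.
Context {R : realType} {n N : nat} {G : lieGroupType R n}.
Variable Phi : G -> 'rV[R]_N -> 'rV[R]_N.
Hypothesis Phi_action : smooth_left_action Phi.

(* If no one-parameter subgroup has velocity xi, then [lie_exp (l *: xi)] takes
   its default value 1 for l != 0, so that the constant curve will do: the
   existence of one-parameter subgroups is not needed. *)
Lemma lie_exp_flow (xi : lie_algebra G) : exists2 gamma,
  weak_subgroup gamma & forall l, Phi (lie_exp (l *: xi)) =1 Phi (gamma l).
Proof.
have [[gamma [g1 gv]]|Nxi] := pselect (exists gamma : R -> G,
  one_parameter_subgroup gamma /\ velocity1 gamma = xi).
  exists gamma => [|l]; first exact: one_parameter_weak.
  have [s1 sv] := one_parameter_subgroup_scale l g1.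
  rewrite /lie_exp.
  case: xgetP => [delta _ [d1 dv]|/(_ (fun t => gamma (t * l)))].
    (* [lie_exp] evaluates [delta] at time 1, to be compared with [fun t => gamma (t * l)] at t =
       1. *)
    rewrite -[in X in _ =1 Phi X](mul1r l).
    apply: (eq_velocity_act Phi_action (one_parameter_weak d1)
      (one_parameter_weak s1)).
    by rewrite dv sv gv.
  by case; split => //; rewrite sv gv.
have [wc cv] := @weak_subgroup_cst1 R n G.
exists (fun=> 1%g) => // l; rewrite /lie_exp.
case: xgetP => [delta _ [d1 dv]|//].
have [l0|l0] := eqVneq l 0; last first.
  have [s1 sv] := one_parameter_subgroup_scale l^-1 d1.
  case: Nxi; exists (fun t => delta (t * l^-1)); split => //.
  by rewrite sv dv scalerA mulVf// scale1r.
(* For l = 0 the chosen subgroup has velocity 0 and hence acts trivially. *)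
apply: (eq_velocity_act Phi_action (one_parameter_weak d1) wc).
by rewrite dv cv l0 scale0r.
Qed.

(** As [(gamma t)^-1 = gamma (- t)], each partial derivative in the lift is, near t = 0, a
    derivative of the local action along Q, evaluated on a differentiable curve. *)
Lemma derivable_cotangent_lift_p gamma z : weak_subgroup gamma ->
  derivable (fun t => (cotangent_lift Phi (gamma t) z).2) (0 : R) 1.
Proof.
move=> wg; set c1 := @lie_chart1 R n G.
have [Ac1 cd1] := (@lie_chart1_atlas R n G, @lie_chart1_dom R n G).
have dq := is_derive_act Phi_action wg (is_derive_cst z.1 (0 : R) 1).
have [wgN _] := weak_subgroup_opp wg.
apply/derivable_mxP => i j.
have -> : (fun t => (cotangent_lift Phi (gamma t) z).2 i j) =
    \sum_(k < N) (fun t => z.2 0 k *: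
      pderiv (Phi (gamma t)^-1%g) j (Phi (gamma t) z.1) 0 k).
  by apply/funext => t; rewrite fct_sumE /= mxE.
apply: derivable_sum => k; apply: derivableZ.
have : derivable
    (fun t => pderiv (Phi (gamma t)^-1%g) j (Phi (gamma t) z.1)) (0 : R) 1.
  (* Order 2 is used: one derivative for the lift, one more along the curve. *)
  have [_ /(_ (0, delta_mx 0 j))[+ _]] := local_action_smooth Phi_action Ac1 2.
  set DL := (fun x => 'D__ _ x) => dDL.
  have dz := is_derive_pair (is_derive_velocity1 wgN) dq.
  have dDL0 : differentiable DL (chart_to c1 (gamma (- 0)), Phi (gamma 0) z.1).
    apply: dDL; split => //; apply: chart_to_cod.
    by rewrite oppr0 (weak_subgroup0 wg).
  have [+ _] := is_derive_diff_comp dDL0 dz.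
  apply: near_eq_derivable; near=> t.
  rewrite /DL /pderiv; apply: eq_derive => h.
  have gt : chart_dom c1 (gamma (- t)).
    by near: t; exact: weak_subgroup_dom wgN.
  by rewrite -(weak_subgroupN t wg) /local_action/= scaler0 add0r !chart_toK.
by move/derivable_mxP; apply.
Unshelve. all: by end_near. Qed.

End LieExpFlow.

(** * The differential of the discrete Hamiltonian and the conservation law *)

Lemma diff_D1D2 (R : realType) (N : nat) (H : 'rV[R]_N -> 'rV[R]_N -> R)
    (x y u v : 'rV[R]_N) :
  let HH := fun z : 'rV[R]_N * 'rV[R]_N => H z.1 z.2 in
  differentiable HH (x, y) ->
  'd HH (x, y) (u, v) = dotv (D1 H x y) u + dotv (D2 H x y) v.
Proof.
move=> HH dH.
(* On a basis vector the differential is a partial derivative of [H]. *)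
have uvE : (u, v) = \sum_(i < N) u 0 i *: (delta_mx 0 i, 0) +
    \sum_(i < N) v 0 i *: (0, delta_mx 0 i) :> 'rV[R]_N * 'rV[R]_N.
  rewrite -big_split/= [in LHS](row_sum_delta u) [in LHS](row_sum_delta v).
  elim/big_rec3: _ => // i a b c _ <-.
  by congr pair; rewrite /= scaler0 ?addr0 ?add0r.
rewrite uvE linearD !linear_sum /dotv; congr (_ + _); apply: eq_bigr => i _;
  rewrite linearZ/= -deriveE// mxE mulrC; congr (_ * _); apply: eq_derive => h;
  by rewrite /HH/= scaler0 add0r.
Qed.

Section DiscreteNoether.
Context {R : realType} {n N : nat} {G : lieGroupType R n}.
Variable Phi : G -> 'rV[R]_N -> 'rV[R]_N.
Hypothesis Phi_action : smooth_left_action Phi.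
Variable H : 'rV[R]_N -> 'rV[R]_N -> R.
Hypothesis H_differentiable : forall z : 'rV[R]_N * 'rV[R]_N,
  differentiable (fun z' : 'rV[R]_N * 'rV[R]_N => H z'.1 z'.2) z.
Hypothesis H_invariant : forall g z,
  discrete_lagrangian H (action_QTQ Phi g z) = discrete_lagrangian H z.

Lemma cotangent_lift1 z : cotangent_lift Phi 1%g z = z.
Proof.
have Phi1 : Phi 1%g = id by apply/funext => q; exact: act1.
rewrite /cotangent_lift invg1 Phi1; case: z => q p; congr pair => /=.
apply/rowP => i; rewrite mxE (bigD1 i)//= big1 => [|j ji].
  by rewrite /pderiv derive_id mxE !eqxx mulr1 addr0.
by rewrite /pderiv derive_id mxE eqxx (negbTE ji) mulr0.
Qed.

Lemma discrete_lagrangian_infinitesimal (xi : lie_algebra G) q q' p' :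
  let xip := (generatorTQ Phi xi (q', p')).2 in
  dotv xip q' + dotv p' (generatorQ Phi xi q') =
  dotv (D1 H q p') (generatorQ Phi xi q) + dotv (D2 H q p') xip.
Proof.
move=> xip; have [gamma wg ge] := lie_exp_flow Phi_action xi.
pose a x t := Phi (gamma t) x.
pose b t := cotangent_lift Phi (gamma t) (q', p').
have genQ x : generatorQ Phi xi x = derive1 (a x) 0.
  by rewrite /generatorQ; congr derive1; apply/funext => l; exact: ge.
have da x : is_derive (0 : R) 1 (a x) (generatorQ Phi xi x).
  have d := is_derive_act Phi_action wg (is_derive_cst x (0 : R) 1).
  by rewrite genQ (derive1_is_derive d).
have dp : is_derive (0 : R) 1 (fun t => (b t).2) xip.
  have db2 := derivableP
    (derivable_cotangent_lift_p Phi_action (z := (q', p')) wg).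
  have -> // : xip = 'D_1 (fun t => (b t).2) 0.
  (* Both components of the lifted curve are differentiable, so its derivative is taken
     componentwise. *)
  rewrite /xip /generatorTQ (_ : (fun l => _) = b).
    by rewrite (derive1_is_derive (is_derive_pair (da q') db2)).
  by apply/funext => l; apply: eq_cotangent_lift => //; exact: ge.
have b0 : b 0 = (q', p') by rewrite /b (weak_subgroup0 wg) cotangent_lift1.
have a0 : a q 0 = q by rewrite /a (weak_subgroup0 wg) act1.
have dd := is_derive_dotv dp (da q').
have ddH := is_derive_pair (da q) dp.
have := @is_derive_diff_comp R _ _ _ (fun t => (a q t, (b t).2)) 0 _
  (H_differentiable _) ddH.
rewrite a0 b0 diff_D1D2//= => dHab.
have : is_derive (0 : R) 1
    (fun t => dotv (b t).2 (a q' t) - H (a q t) (b t).2) _ :=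
  is_deriveB dd dHab.
(* By invariance the discrete Lagrangian is constant along the flow, so the derivative just computed
   is 0. *)
have -> : (fun t => dotv (b t).2 (a q' t) - H (a q t) (b t).2) =
    cst (discrete_lagrangian H (q, (q', p'))).
  by apply/funext => t; rewrite -(H_invariant (gamma t)).
rewrite b0 /a (weak_subgroup0 wg) act1// => -[_ /eqP].
by rewrite derive_cst eq_sym subr_eq0 => /eqP.
Qed.

Lemma momentum_preserved (xi : lie_algebra G) (q q' p p' fm fp : 'rV[R]_N) :
  dotv fm (generatorQ Phi xi q) +
    dotv fp (generatorTQ Phi xi (q', p')).2 = 0 ->
  q' = D2 H q p' - fp -> p = D1 H q p' - fm ->
  dotv p' (generatorQ Phi xi q') = dotv p (generatorQ Phi xi q).
Proof.
have dotC (u v : 'rV[R]_N) : dotv u v = dotv v u.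
  by apply: eq_bigr => i _; rewrite mulrC.
have dotD (u v w : 'rV[R]_N) : dotv (u + v) w = dotv u w + dotv v w.
  by rewrite /dotv -big_split/=; apply: eq_bigr => i _; rewrite mxE mulrDl.
move=> F0 q'E pE; have := discrete_lagrangian_infinitesimal xi q q' p'.
(* After both substitutions the products of [q'] with the p-generator cancel, and the force terms
   add up to 0 by [F0]. *)
have -> : D2 H q p' = q' + fp by rewrite q'E subrK.
have -> : D1 H q p' = p + fm by rewrite pE subrK.
rewrite /= !dotD (dotC _ q') => dL; lra.
Qed.

End DiscreteNoether.

(* H k, Fm k and Fp k belong to the step from t_k to t_(k+1). *)
Theorem theorem3p2 (R : realType) (d : measure_display)
    (Omega : measurableType d) (P : probability Omega R) (n N : nat)
    (G : lieGroupType R n) (Phi : G -> 'rV[R]_N -> 'rV[R]_N)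
    (J : 'rV[R]_N * 'rV[R]_N -> lie_dual G) (K : nat)
    (H : nat -> Omega -> 'rV[R]_N -> 'rV[R]_N -> R)
    (Fm Fp : nat -> Omega -> 'rV[R]_N -> 'rV[R]_N -> 'rV[R]_N)
    (q p : nat -> Omega -> 'rV[R]_N)
    (Phi_action : smooth_left_action Phi)
    (J_momentum : cotangent_momentum_map Phi J)
    (H_random : forall k x y, (k < K)%N ->
       measurable_fun [set: Omega] (fun w => H k w x y))
    (H_differentiable : forall k, (k < K)%N ->
       {ae P, forall w, forall z : 'rV[R]_N * 'rV[R]_N,
          differentiable (fun z' : 'rV[R]_N * 'rV[R]_N => H k w z'.1 z'.2) z})
    (Fm_random : forall k x y, (k < K)%N -> random_vector (fun w => Fm k w x y))
    (Fp_random : forall k x y, (k < K)%N -> random_vector (fun w => Fp k w x y))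
    (R_invariant : forall k, (k < K)%N ->
       {ae P, forall w, forall g z,
          discrete_lagrangian (H k w) (action_QTQ Phi g z) =
          discrete_lagrangian (H k w) z})
    (forces_condition : forall k, (k < K)%N ->
       {ae P, forall w, forall (xi : lie_algebra G) (x x' y' : 'rV[R]_N),
          dotv (Fm k w x y') (generatorQ Phi xi x) +
          dotv (Fp k w x y') (generatorTQ Phi xi (x', y')).2 = 0})
    (q_random : forall k, (k <= K)%N -> random_vector (q k))
    (p_random : forall k, (k <= K)%N -> random_vector (p k))
    (solution : forall k, (k < K)%N ->
       {ae P, forall w,
          q k.+1 w = D2 (H k w) (q k w) (p k.+1 w) - Fp k w (q k w) (p k.+1 w) /\
          p k w = D1 (H k w) (q k w) (p k.+1 w) - Fm k w (q k w) (p k.+1 w)}) :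
  {ae P, forall w, forall k, (k < K)%N ->
     J (q k.+1 w, p k.+1 w) = J (q k w, p k w)}.
Proof.
(* There is one exceptional null set for each k, hence countably many. *)
apply: ae_foralln => k; have [kK|_] := boolP (k < K)%N; last first.
  exact: aeW.
apply: filter_app (solution _ kK); apply: filter_app (forces_condition _ kK).
apply: filter_app (R_invariant _ kK).
apply: filter_app (H_differentiable _ kK).
(* Outside the null sets of the four hypotheses, the argument is deterministic at a fixed [w]. *)
apply: aeW => w dH invH F0 [qE pE] _.
apply/lfunP => xi; rewrite !J_momentum.
exact: (momentum_preserved Phi_action dH invH (F0 xi _ _ _) qE pE).
Qed.
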